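(* Let $m\ge 2$ and let $f:\{0,1\}^n\to\{0,1\}$ be a Boolean function having a linear characteristic $\chi_f=\{g_1,\dots,g_l\}$ over $\mathbb{Z}_m$. Then $f$ can be computed with one-sided error (i.e. inputs in $f^{-1}(1)$ accepted with probability $1$, inputs in $f^{-1}(0)$ accepted with probability at most some constant $\delta<1$) by a quantum OBDD of width $O(2^{|\chi_f|}\log m)$.
   Context: A characteristic of a Boolean function $f(x_1,\dots,x_n)$ over $\mathbb{Z}_m$ is a finite set $\chi_f$ of polynomials with coefficients in $\mathbb{Z}_m$ such that for every $\sigma\in\{0,1\}^n$: $g(\sigma)=0$ in $\mathbb{Z}_m$ for all $g\in\chi_f$ if and only if $f(\sigma)=1$. It is linear if each polynomial in it has the form $c_1x_1+\dots+c_nx_n+c_0$ with $c_i\in\mathbb{Z}_m$. A quantum branching program (QBP) over $\mathbb{C}^d$ is a triple $\langle T,|\psi_0\rangle,Accept\rangle$ with unit initial state $|\psi_0\rangle$, $Accept\subseteq\{1,\dots,d\}$, and instructions $T_j=(x_{i_j},U_j(0),U_j(1))$, $j=1,\dots,l$, with $U_j(0),U_j(1)$ unitary $d\times d$ matrices; on input $\sigma$ the final state is $U_l(\sigma_{i_l})\cdots U_1(\sigma_{i_1})|\psi_0\rangle=(\alpha_1,\dots,\alpha_d)^T$ and $\sigma$ is accepted with probability $\sum_{i\in Accept}|\alpha_i|^2$. The width is $d$. A quantum OBDD is a QBP in which each variable occurs at most once in $T$. *)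

(* Defs.v *)
From mathcomp Require Import all_boot all_order all_algebra.
From mathcomp Require Import spectral finmap.
From mathcomp Require Import complex.
From mathcomp Require Import -(notations) mpoly.
From mathcomp Require Import reals exp.
Set Implicit Arguments.
Unset Strict Implicit.
Unset Printing Implicit Defensive.
Import Order.TTheory GRing.Theory Num.Theory.
Local Open Scope ring_scope.

(* Intended for 1 < m only: 'Z_0 and 'Z_1 both denote the integers mod 2. *)
Definition bool_poly_eval (m n : nat) (g : mpoly n 'Z_m)
    (sigma : n.-tuple bool) : 'Z_m :=
  meval (fun i : 'I_n => (tnth sigma i : nat)%:R) g.

Definition is_characteristic (m n : nat) (f : n.-tuple bool -> bool)
    (chi : {fset mpoly n 'Z_m}) : Prop :=
  forall sigma : n.-tuple bool,
    (forall g, g \in chi -> bool_poly_eval g sigma = 0) <-> f sigma = true.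

Definition linear_polynomial (m n : nat) (g : mpoly n 'Z_m) : Prop :=
  exists (c : 'I_n -> 'Z_m) (c0 : 'Z_m),
    g = (\sum_(i < n) c i *: mpolyX 'Z_m (mnm1 i))
        + mpolyC n c0.

Definition is_linear_characteristic (m n : nat) (f : n.-tuple bool -> bool)
    (chi : {fset mpoly n 'Z_m}) : Prop :=
  is_characteristic f chi /\ forall g, g \in chi -> linear_polynomial g.

Record qbp_instruction (R : realType) (n d : nat) := QBPInstruction {
  instr_var : 'I_n;
  instr_mx : bool -> 'M[R[i]]_d;
  instr_unitary : forall b, instr_mx b \is unitarymx
}.

Definition weight (R : realType) (d : nat) (A : {set 'I_d})
    (psi : 'cV[R[i]]_d) : R :=
  \sum_(i in A) ComplexField.Normc.normc (psi i 0) ^+ 2.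

(* The width is the parameter d. *)
Record qbp (R : realType) (n d : nat) := QBP {
  qbp_program : seq (qbp_instruction R n d);
  qbp_init : 'cV[R[i]]_d;
  qbp_accept : {set 'I_d};
  qbp_init_unit : weight [set: 'I_d] qbp_init = 1
}.

Definition qbp_final (R : realType) (n d : nat) (Q : qbp R n d)
    (sigma : n.-tuple bool) : 'cV[R[i]]_d :=
  foldl (fun psi T => instr_mx T (tnth sigma (instr_var T)) *m psi)
    (qbp_init Q) (qbp_program Q).

Definition accept_prob (R : realType) (n d : nat) (Q : qbp R n d)
    (sigma : n.-tuple bool) : R :=
  weight (qbp_accept Q) (qbp_final Q sigma).

Definition is_obdd (R : realType) (n d : nat) (Q : qbp R n d) : bool :=
  uniq [seq instr_var T | T <- qbp_program Q].

Definition computes_one_sided (R : realType) (n d : nat) (Q : qbp R n d)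
    (f : n.-tuple bool -> bool) (delta : R) : Prop :=
  forall sigma : n.-tuple bool,
    (f sigma = true -> accept_prob Q sigma = 1) /\
    (f sigma = false -> accept_prob Q sigma <= delta).

(* Main.v *)
Require Import Defs.
From mathcomp Require Import all_boot all_order all_algebra.
From mathcomp Require Import cyclic separable cyclotomic.
From mathcomp Require Import finmap complex.
From mathcomp Require Import -(notations) mpoly.
From mathcomp Require Import reals sequences exp.
From mathcomp Require Import ring lra.
Import Order.TTheory GRing.Theory Num.Theory.
Local Open Scope ring_scope.

(** Fix a primitive [m]-th root of unity [w] and multipliers [k_1, ..., k_t].
Start from the uniform superposition of the states [(i, S)], with [i <= t] and
[S] a subset of [chi], and let the program multiply the amplitude of [(i, S)]
by [w ^ (k_i * sum_(g in S) g(sigma))]: since the [g] are linear, each variable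
contributes one diagonal unitary. The overlap of the result with the uniform
superposition is the mean over [i] of [prod_g (1 + w ^ (k_i g(sigma))) / 2]. It
is [1] if every [g(sigma)] vanishes. If [g(sigma) <> 0], its modulus is at most
the mean over [i] of [3/4 + Re (w ^ (k_i g(sigma))) / 4].

It remains to find [t = O(log m)] multipliers for which the mean over [i] of
[Re (w ^ (k_i x))] is at most [1/2] for every nonzero [x]. As
[Re (w ^ (k x))] has mean [0] over all [k], they can be chosen one by one, so
that [sum_x exp ((sum_i Re (w ^ (k_i x))) / 8)] stays below
[m * exp (t / 32)]. *)

Local Notation normc := ComplexField.Normc.normc.
Local Notation Re := complex.Re.
Local Notation Im := complex.Im.

(** * Moduli, real parts and roots of unity *)

Section ComplexNorm.
Context {R : realType}.
Implicit Types z : R[i].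

Lemma sqr_normcE z : normc z ^+ 2 = Re z ^+ 2 + Im z ^+ 2.
Proof. by case: z => a b /=; rewrite sqr_sqrtr // addr_ge0 ?sqr_ge0. Qed.

Lemma normc_ge0 z : 0 <= normc z.
Proof. by case: z => a b; apply: sqrtr_ge0. Qed.

Lemma norm_normc z : `|z| = (normc z)%:C%C.
Proof. by []. Qed.

Lemma normc_sum (I : Type) (r : seq I) (P : pred I) (F : I -> R[i]) :
  normc (\sum_(i <- r | P i) F i) <= \sum_(i <- r | P i) normc (F i).
Proof.
have := ler_norm_sum r F P.
under [X in _ <= X]eq_bigr do rewrite norm_normc.
by rewrite norm_normc -rmorph_sum /= lecR.
Qed.

Lemma normc_prod (I : Type) (r : seq I) (P : pred I) (F : I -> R[i]) :
  normc (\prod_(i <- r | P i) F i) = \prod_(i <- r | P i) normc (F i).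
Proof.
elim/big_rec2: _ => [|i x y _ <-]; first exact: ComplexField.Normc.normc1.
exact: ComplexField.Normc.normcM.
Qed.

Lemma normc_real (x : R) : normc x%:C%C = `|x|.
Proof. by rewrite /= expr0n addr0 sqrtr_sqr. Qed.

Lemma normc_root1 (m : nat) z : (0 < m)%N -> z ^+ m = 1 -> normc z = 1.
Proof.
move=> m0 zm; apply/(@complexI R); rewrite -norm_normc.
by apply/eqP; rewrite -(pexpr_eq1 m0) // -normrX zm normr1.
Qed.

Lemma Re_normc1 z : normc z = 1 -> -1 <= Re z <= 1.
Proof.
move=> z1; have := sqr_normcE z; rewrite z1 => h.
by have := sqr_ge0 (Im z); nra.
Qed.

(** With [a = Re z], the square of the left side is [2 + 2 * a], and the square of the right side
    exceeds it by [(a - 1) ^+ 2 / 4]. A bound affine in [Re z] can be averaged over the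
    multipliers. *)
Lemma normc_1D z : normc z = 1 -> normc (1 + z) <= 3 / 2 + Re z / 2.
Proof.
move=> z1; have /andP[a1 _] := Re_normc1 _ z1.
rewrite -ler_sqr ?nnegrE ?normc_ge0 //; last by lra.
have := sqr_normcE z; rewrite z1 sqr_normcE.
by case: z {z1 a1} => a b /=; have := sqr_ge0 (a - 1); nra.
Qed.

Lemma normc_1D_le2 z : normc z = 1 -> normc (1 + z) <= 2.
Proof. by move=> z1; have := normc_1D _ z1; have := Re_normc1 _ z1; lra. Qed.

(** ['X^n - 1] splits and is separable in characteristic 0, so it has [n] distinct roots; a field
    with that many [n]-th roots of unity has a primitive one. *)
Lemma complex_prim_root (n : nat) :
  (0 < n)%N -> exists z : R[i], n.-primitive_root z.
Proof.
pose p : {poly R[i]} := 'X^n - 1; have [r Dp] := closed_field_poly_normal p.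
move=> n_gt0; rewrite (monicP _) ?monicXnsubC // scale1r in Dp.
have rn1 : all n.-unity_root r.
  by apply/allP=> z; rewrite -root_prod_XsubC -Dp.
have sz_r : (n < (size r).+1)%N.
  by rewrite -(size_prod_XsubC r id) -Dp size_XnsubC.
have [|z] := hasP (has_prim_root n_gt0 rn1 _ sz_r); last by exists z.
by rewrite -separable_prod_XsubC -Dp separable_Xn_sub_1 // pnatr_eq0 -lt0n.
Qed.

Lemma Re_sum_root1 (m : nat) z : z ^+ m = 1 -> z != 1 ->
  \sum_(k < m) Re (z ^+ k) = 0.
Proof.
move=> zm z1; rewrite -(raddf_sum (@Re R)) /=.
have /eqP := subrX1 z m; rewrite zm subrr eq_sym mulf_eq0 subr_eq0 (negPf z1) /=.
by move=> /eqP->.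
Qed.
End ComplexNorm.

(** * Choice of logarithmically many multipliers *)

Section Multipliers.
Context {R : realType}.

(** From [expR (- x) >= 1 - x] one gets [expR x * (1 - x) <= 1]; the quadratic times [1 - x] is at
    least 1 as soon as [x <= 1 / 2]. *)
Lemma expR_quad (x : R) : x <= 1 / 2 -> expR x <= 1 + x + 2 * x ^+ 2.
Proof.
move=> x2; have := expR_ge1Dx (- x).
have := expRxMexpNx_1 x; have := expR_gt0 x.
set e := expR x; set e' := expR (- x) => e0 ee h.
have : e * (1 - x) <= 1 by rewrite -[X in _ <= X]ee ler_pM2l.
have q0 : 0 <= x ^+ 2 * (1 - 2 * x) by rewrite mulr_ge0 ?sqr_ge0 //; lra.
move=> h1; rewrite -(ler_pM2r (_ : 0 < 1 - x)); last by lra.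
apply: le_trans h1 _.
have -> : (1 + x + 2 * x ^+ 2) * (1 - x) = 1 + x ^+ 2 * (1 - 2 * x) by ring.
by lra.
Qed.

(** The linear term has mean 0 and the quadratic one is at most [2 * (1 / 8) ^+ 2 = 1 / 32]. *)
Lemma mean_expR_le (m : nat) (y : 'I_m -> R) :
  (forall k, -1 <= y k <= 1) -> \sum_k y k = 0 ->
  \sum_k expR (y k / 8) <= m%:R * expR 32^-1.
Proof.
move=> y1 y0; apply: (@le_trans _ _ (\sum_(k < m) (1 + 32^-1 + y k / 8))).
  apply: ler_sum => k _; have yk := y1 k.
  by apply: le_trans (expR_quad _ _) _; nra.
rewrite big_split /= -mulr_suml y0 mul0r addr0 sumr_const card_ord.
rewrite -[X in X <= _]mulr_natl.
by rewrite ler_wpM2l ?expR_ge1Dx.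
Qed.

(* Greedy derandomisation: averaging over the next multiplier shows that some
   choice does not increase the exponential potential by more than the mean. *)
Lemma greedy_potential (T : finType) (m t : nat) (y : T -> 'I_m -> R) :
  (0 < m)%N -> (forall x k, -1 <= y x k <= 1) ->
  (forall x, \sum_k y x k = 0) ->
  exists ks : 'I_t -> 'I_m,
    \sum_x expR ((\sum_i y x (ks i)) / 8) <= #|T|%:R * expR (t%:R / 32).
Proof.
move=> m0 y1 y0; elim: t => [|t [ks IH]].
  exists (fun _ => Ordinal m0).
  under eq_bigr do rewrite big_ord0 mul0r expR0.
  by rewrite mul0r expR0 mulr1 sumr_const.
pose phi x := expR ((\sum_i y x (ks i)) / 8).
pose pot k := \sum_x phi x * expR (y x k / 8).
have [k hk] : exists k, pot k <= (\sum_x phi x) * expR 32^-1.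
  apply/existsP; rewrite -[X in is_true X]negbK negb_exists.
  apply/negP => /forallP h.
  suff : m%:R * ((\sum_x phi x) * expR 32^-1) < \sum_k pot k.
    rewrite ltNge => /negP[]; rewrite exchange_big /=.
    rewrite mulrCA mulr_suml; apply: ler_sum => x _.
    by rewrite -mulr_sumr ler_wpM2l ?expR_ge0 ?mean_expR_le.
  have -> : m%:R * ((\sum_x phi x) * expR 32^-1)
          = \sum_(k < m) (\sum_x phi x) * expR 32^-1.
    by rewrite sumr_const card_ord mulr_natl.
  apply: ltr_sum => [|k _]; last by rewrite ltNge h.
  by apply/hasP; exists (Ordinal m0); rewrite ?mem_index_enum.
exists (fun i => if unlift ord_max i is Some j then ks j else k).
apply: (@le_trans _ _ (pot k)).
  apply: ler_sum => x _; rewrite -expRD -mulrDl big_ord_recr /= unlift_none.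
  under eq_bigr => i _.
    have -> : widen_ord (leqnSn t) i = lift ord_max i.
      by apply: val_inj; rewrite /= /bump leqNgt ltn_ord.
    rewrite liftK; over.
  by [].
apply: (le_trans hk); rewrite -[t.+1%:R]natr1 mulrDl mul1r expRD mulrA.
by rewrite ler_wpM2r ?expR_ge0.
Qed.

(** A single term of the potential is at most the whole, hence at most [m * expR (t / 32)]. Taking
    logarithms, the sum is at most [8 * ln m + t / 4], and [8 * ln m <= t / 4]. *)
Lemma balanced_multipliers (m t : nat) (w : R[i]) :
  m.-primitive_root w -> 32 * ln m%:R <= t%:R :> R ->
  exists ks : 'I_t -> 'I_m, forall g : 'I_m, (0 < g)%N ->
    \sum_i Re (w ^+ g ^+ ks i) <= t%:R / 2.
Proof.
move=> pw tm; have m0 := prim_order_gt0 pw.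
pose T : finType := {g : 'I_m | (0 < g)%N}.
pose y (x : T) (k : 'I_m) := Re (w ^+ val x ^+ k).
have wm (g : nat) : w ^+ g ^+ m = 1.
  by rewrite -exprM mulnC exprM (prim_expr_order pw) expr1n.
have y1 x k : -1 <= y x k <= 1.
  apply: Re_normc1; apply: (@normc_root1 _ m) => //.
  by rewrite -exprM mulnC exprM wm expr1n.
have y0 x : \sum_k y x k = 0.
  apply: Re_sum_root1 => //; rewrite -(prim_order_dvd pw).
  by rewrite gtnNdvd ?ltn_ord ?(valP x).
have [ks h] := greedy_potential T m t y m0 y1 y0.
exists ks => g g0; pose x : T := exist _ g g0.
have : expR ((\sum_i y x (ks i)) / 8) <= expR (ln m%:R + t%:R / 32).
  rewrite expRD lnK ?posrE ?ltr0n //.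
  apply: (@le_trans _ _ (#|T|%:R * expR (t%:R / 32))); last first.
    rewrite ler_wpM2r ?expR_ge0 // ler_nat card_sig.
    by rewrite (leq_trans (max_card _)) ?card_ord.
  apply: le_trans h; rewrite (bigD1 x) //= lerDl.
  by apply: sumr_ge0 => z _; apply: expR_ge0.
by rewrite ler_expR /y /=; lra.
Qed.
End Multipliers.

(** * Programs that apply phases to a uniform superposition *)

Section PhaseProgram.
Context {R : realType}.

Section Reflection.
Variable d : nat.

Let s : R := (Num.sqrt d.+1%:R)^-1.
(** The axis of the reflection: |0> plus the uniform superposition. Its squared norm is
    [2 * (1 + s)], so [(1 + s)^-1] below is the usual factor 2 / |u|^2. *)
Let u : 'cV[R]_d.+1 := \col_i (s + (i == ord0)%:R).

(* The reflection exchanging the basis state |0> and the uniform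
   superposition; it plays the role of the Hadamard transform. *)
Definition uniform_reflection : 'M[R[i]]_d.+1 :=
  map_mx (real_complex R) ((1 + s)^-1 *: (u *m u^T) - 1%:M).

Let s_gt0 : 0 < s.
Proof. by rewrite invr_gt0 sqrtr_gt0 ltr0n. Qed.

Let s_sqr : s ^+ 2 = d.+1%:R^-1.
Proof. by rewrite exprVn sqr_sqrtr ?ler0n. Qed.

Let u_sqr : u^T *m u = (2 * (1 + s))%:M.
Proof.
apply/matrixP => i j; rewrite !ord1 !mxE /= mulr1n.
under eq_bigr => k _.
  rewrite !mxE (_ : _ * _ = s ^+ 2 + (k == ord0)%:R * (2 * s + 1)); last first.
    by case: eqP => _; rewrite ?mulr1n ?mulr0n; ring.
  over.
rewrite big_split /= sumr_const card_ord s_sqr.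
rewrite -[X in X + _]mulr_natl divff ?pnatr_eq0 //.
rewrite -mulr_suml (bigD1 ord0) //= big1 ?addr0; first by ring.
by move=> k /negPf->.
Qed.

Lemma uniform_reflectionK : uniform_reflection *m uniform_reflection = 1%:M.
Proof.
rewrite -map_mxM -(map_mx1 (real_complex R)); congr map_mx.
set P := u *m u^T.
have PP : P *m P = (2 * (1 + s)) *: P.
  by rewrite /P mulmxA -[_ *m _ *m u]mulmxA u_sqr mul_mx_scalar scalemxAl.
rewrite mulmxBl !mulmxBr !mul1mx !mulmx1 -scalemxAl -scalemxAr PP !scalerA.
have -> : (1 + s)^-1 * (1 + s)^-1 * (2 * (1 + s)) = (1 + s)^-1 + (1 + s)^-1.
  by field; move: s_gt0; lra.
rewrite scalerDl opprB; set Q := _ *: P.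
by rewrite addrK addrC subrK.
Qed.

(** The matrix is a real symmetric involution. *)
Lemma uniform_reflection_unitary : uniform_reflection \is unitarymx.
Proof.
apply/unitarymxP; rewrite -[RHS]uniform_reflectionK; congr (_ *m _).
apply/matrixP => i j; rewrite !mxE; etransitivity; first exact: conjc_real.
by rewrite !big_ord1 !mxE (eq_sym j i) [(s + (j == _)%:R) * _]mulrC.
Qed.

Lemma uniform_reflection_row0 i :
  uniform_reflection ord0 i = (Num.sqrt d.+1%:R)^-1%:C%C.
Proof.
rewrite !mxE /= big_ord1 !mxE eqxx; congr _%:C%C; rewrite eq_sym /=.
by rewrite -/s mulr1n; field; move: s_gt0; lra.
Qed.
End Reflection.

Lemma weightTE (d : nat) (psi : 'cV[R[i]]_d) :
  (weight [set: 'I_d] psi)%:C%C = (map_mx Num.conj psi^T *m psi) 0 0.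
Proof.
rewrite /weight rmorph_sum /= mxE; apply: eq_big => [i|i _]; first by rewrite inE.
by rewrite !mxE rmorphXn /= -norm_normc normCK mulrC.
Qed.

Lemma weightT_unitary (d : nat) (U : 'M[R[i]]_d) (psi : 'cV[R[i]]_d) :
  U \is unitarymx -> weight [set: 'I_d] (U *m psi) = weight [set: 'I_d] psi.
Proof.
move=> /unitarymxP/mulmx1C UU; apply/(@complexI R); rewrite !weightTE.
by rewrite trmx_mul map_mxM /= -mulmxA (mulmxA _ U) UU mul1mx.
Qed.

Lemma diag_unitary (d : nat) (a : 'I_d -> R[i]) :
  (forall i, normc (a i) = 1) -> diag_mx (\row_i a i) \is unitarymx.
Proof.
move=> a1; apply/unitarymxP; rewrite tr_diag_mx map_diag_mx mulmx_diag.
rewrite -diag_const_mx; congr diag_mx; apply/rowP => i; rewrite !mxE.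
by rewrite -normCK norm_normc a1 expr1n.
Qed.

Lemma normc_if (b : bool) (z : R[i]) :
  normc z = 1 -> normc (if b then z else 1) = 1.
Proof. by case: b => // _; apply: ComplexField.Normc.normc1. Qed.

Section Program.
Context {n d : nat} {a : 'I_n -> 'I_d.+1 -> R[i]}.
Hypothesis a1 : forall j i, normc (a j i) = 1.

Let G := uniform_reflection d.
Let D j (b : bool) := diag_mx (\row_i (if b then a j i else 1)).

Let phase_unitary j b : G *m D j b *m G \is unitarymx.
Proof.
rewrite !mul_unitarymx ?uniform_reflection_unitary ?diag_unitary // => i.
exact: normc_if.
Qed.

(** Every instruction must read a variable, so the changes of basis are absorbed by conjugation:
    adjacent factors [G] cancel, and the last one turns the overlap with the uniform superposition
    into the amplitude of |0>. *)
Definition phase_instruction j : qbp_instruction R n d.+1 :=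
  QBPInstruction j (phase_unitary j).

Lemma phase_run (sigma : n.-tuple bool) (js : seq 'I_n) (v : 'cV[R[i]]_d.+1) :
  foldl (fun psi T => instr_mx T (tnth sigma (instr_var T)) *m psi)
    (G *m v) [seq phase_instruction j | j <- js]
  = G *m \col_i (v i 0 * \prod_(j <- js) (if tnth sigma j then a j i else 1)).
Proof.
elim: js v => [|j js IH] v /=.
  by congr (_ *m _); apply/colP => i; rewrite mxE big_nil mulr1.
rewrite -mulmxA (mulmxA G) uniform_reflectionK mul1mx -mulmxA IH /D mul_diag_mx.
congr (_ *m _); apply/colP => i; rewrite !mxE big_cons.
by rewrite mulrCA mulrA.
Qed.
End Program.

Lemma phase_qbp (n d : nat) (a0 : 'I_d -> R[i]) (a : 'I_n -> 'I_d -> R[i]) :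
  (0 < d)%N -> (forall i, normc (a0 i) = 1) ->
  (forall j i, normc (a j i) = 1) ->
  exists Q : qbp R n d, is_obdd Q /\ forall sigma, accept_prob Q sigma =
    (normc (\sum_i a0 i * \prod_j (if tnth sigma j then a j i else 1))
       / d%:R) ^+ 2.
Proof.
case: d a0 a => // d a0 a _ a01 a1.
pose s : R := (Num.sqrt d.+1%:R)^-1.
have s2 : s ^+ 2 = d.+1%:R^-1 by rewrite exprVn sqr_sqrtr ?ler0n.
have s0 : 0 <= s by rewrite invr_ge0 sqrtr_ge0.
(* The phases [a0], which depend on no variable, are put into the initial state. *)
pose v : 'cV[R[i]]_d.+1 := \col_i (s%:C%C * a0 i).
have v1 : weight [set: 'I_d.+1] (uniform_reflection d *m v) = 1.
  rewrite weightT_unitary ?uniform_reflection_unitary // /weight.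
  under eq_bigr => i _.
    rewrite mxE ComplexField.Normc.normcM a01 mulr1 normc_real real_normK ?num_real //; over.
  by rewrite s2 sumr_const cardsT card_ord -[LHS]mulr_natl divff ?pnatr_eq0.
exists (QBP [seq phase_instruction a1 j | j <- enum 'I_n] [set ord0] v1).
split=> [|sigma].
  by rewrite /is_obdd -map_comp map_id enum_uniq.
rewrite /accept_prob /qbp_final /= phase_run /weight big_set1; congr (_ ^+ 2).
rewrite mxE (eq_bigr (fun i => (d.+1%:R^-1)%:C%C *
   (a0 i * \prod_j (if tnth sigma j then a j i else 1)))) => [|i _].
  rewrite -mulr_sumr ComplexField.Normc.normcM normc_real mulrC.
  by rewrite ger0_norm ?invr_ge0 ?ler0n.
rewrite uniform_reflection_row0 !mxE -/s -s2 rmorphXn /= big_enum /=.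
by rewrite expr2 !mulrA.
Qed.

Lemma phase_qbp_fin (n : nat) (T : finType) (a0 : T -> R[i])
    (a : 'I_n -> T -> R[i]) :
  (0 < #|T|)%N -> (forall x, normc (a0 x) = 1) ->
  (forall j x, normc (a j x) = 1) ->
  exists Q : qbp R n #|T|, is_obdd Q /\ forall sigma, accept_prob Q sigma =
    (normc (\sum_x a0 x * \prod_j (if tnth sigma j then a j x else 1))
       / #|T|%:R) ^+ 2.
Proof.
move=> T0 a01 a1.
have [Q [oQ hQ]] := phase_qbp n #|T| (fun i => a0 (enum_val i))
  (fun j i => a j (enum_val i)) T0 (fun i => a01 _) (fun j i => a1 _ _).
exists Q; split=> // sigma; rewrite hQ; congr ((normc _ / _) ^+ 2).
by rewrite [RHS]big_enum_val.
Qed.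
End PhaseProgram.

(** * Subset sums and additive characters of ['Z_m] *)

(** The sum factors as the product of the [1 + x i]; every factor other than that of [i0] has
    modulus at most 2. *)
Lemma normc_subset_sum {R : realType} {I : finType} (x : I -> R[i]) (i0 : I) :
  (forall i, normc (x i) = 1) ->
  normc (\sum_(S : {set I}) \prod_(i in S) x i)
    <= 2 ^+ #|I| * (normc (1 + x i0) / 2).
Proof.
move=> x1; have -> : \sum_(S : {set I}) \prod_(i in S) x i = \prod_i (1 + x i).
  under [RHS]eq_bigr do rewrite addrC.
  by rewrite bigA_distr; apply: eq_bigr => S _; rewrite big_mkcond.
rewrite normc_prod (bigD1 i0) //= mulrC.
have I0 : (0 < #|I|)%N by apply/card_gt0P; exists i0.
have -> : 2 ^+ #|I| * (normc (1 + x i0) / 2)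
        = 2 ^+ #|I|.-1 * normc (1 + x i0) :> R.
  by rewrite -[in LHS](prednK I0) exprS; field.
rewrite ler_wpM2r ?normc_ge0 // -(cardC1 i0) -prodr_const.
by apply: ler_prod => i _; rewrite normc_ge0 normc_1D_le2.
Qed.

Lemma linear_polynomial_eval (m n : nat) (c : 'I_n -> 'Z_m) (c0 : 'Z_m)
    (sigma : n.-tuple bool) :
  bool_poly_eval ((\sum_(i < n) c i *: mpolyX 'Z_m (mnm1 i)) + mpolyC n c0) sigma
  = c0 + \sum_(i < n) (if tnth sigma i then c i else 0).
Proof.
rewrite /bool_poly_eval mevalD mevalC addrC raddf_sum; congr (_ + _).
apply: eq_bigr => i _; rewrite /= mevalZ mevalXU.
by case: (tnth sigma i); rewrite ?mulr1 ?mulr0.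
Qed.

Section Characters.
Context {R : realType} {m : nat} {w : R[i]}.
Hypotheses (m_gt1 : (1 < m)%N) (pw : m.-primitive_root w).

(** Reduction modulo [m] in the exponent is harmless because [w] has order [m]. *)
Lemma charD (x y : 'Z_m) : w ^+ (x + y)%R = w ^+ x * w ^+ y.
Proof. 
rewrite -exprD -(prim_expr_mod pw (x + y)%N).
by rewrite -[X in _ = w ^+ (_ %% X)](Zp_cast m_gt1).
 Qed.

Lemma char_affine (n : nat) (c : 'I_n -> 'Z_m) (c0 : 'Z_m)
    (sigma : n.-tuple bool) :
  w ^+ (c0 + \sum_i (if tnth sigma i then c i else 0))%R
  = w ^+ c0 * \prod_i (if tnth sigma i then w ^+ c i else 1).
Proof.
rewrite charD; congr (_ * _).
rewrite (big_morph (fun x : 'Z_m => w ^+ x) charD (erefl : w ^+ (0 : 'Z_m)%R = 1)).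
by apply: eq_bigr => i _; case: (tnth sigma i).
Qed.

Lemma normc_char (x : nat) : normc (w ^+ x) = 1.
Proof.
apply: (@normc_root1 _ m); first exact: ltnW.
by rewrite exprAC (prim_expr_order pw) expr1n.
Qed.
End Characters.

(** Absorbs the rounding of the number of multipliers into a multiple of [ln m]. *)
Lemma ln_nat_ge_half {R : realType} (m : nat) : (1 < m)%N -> 1 / 2 <= ln m%:R :> R.
Proof.
move=> m1; rewrite -ler_expR lnK ?posrE ?ltr0n 1?ltnW //.
apply: (@le_trans _ _ 2); last by rewrite ler_nat.
by apply: le_trans (expR_quad _ _) _; lra.
Qed.

Theorem theorem3 (R : realType) :
  exists delta C : R, delta < 1 /\
    forall (m n : nat) (f : n.-tuple bool -> bool)
      (chi : {fset mpoly n 'Z_m}),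
      (2 <= m)%N ->
      is_linear_characteristic f chi ->
      exists (d : nat) (Q : qbp R n d),
        [/\ is_obdd Q,
            computes_one_sided Q f delta &
            d%:R <= C * (2 ^+ #|` chi| * ln m%:R)].
Proof.
(* [7 / 8] is [3 / 4 + re / 4] at mean real part [1 / 2], squared to give a probability. [34] is the
   32 required of [t], plus 2 since rounding adds at most [1 <= 2 * ln m]. *)
exists ((7 / 8) ^+ 2), 34; split; first by lra.
move=> m n f chi m1 [chif chiL].
have [w pw] := @complex_prim_root R m (ltnW m1).
have lnm := @ln_nat_ge_half R m m1.
pose t := (Num.truncn (32 * ln m%:R : R)).+1.
have /andP[t_lo t_hi] : 32 * ln (m%:R : R) <= t%:R <= 34 * ln (m%:R : R).
  have h : 0 <= 32 * ln m%:R :> R by lra.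
  have /andP[h1 h2] := truncn_itv h.
  by rewrite ltW //= /t -[_.+1%:R]natr1; lra.
have t0 : (0 < t)%N by [].
have [ks ksP] := balanced_multipliers m t w pw t_lo.
have /fin_all_exists[c /fin_all_exists[c0 cE]] : forall g : chi,
    exists c : 'I_n -> 'Z_m, exists c0 : 'Z_m,
    forall sigma, bool_poly_eval (val g) sigma
      = c0 + \sum_(i < n) (if tnth sigma i then c i else 0).
  move=> g; have [c [c0 ->]] := chiL _ (valP g).
  by exists c, c0 => sigma; apply: linear_polynomial_eval.
pose T : finType := ('I_t * {set chi})%type.
have cardT : #|T| = (t * 2 ^ #|` chi|)%N.
  by rewrite card_prod card_ord -cardsT -powersetT card_powerset cardsT cardfE.
have T0 : (0 < #|T|)%N by rewrite cardT muln_gt0 t0 expn_gt0.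
pose a0 (x : T) := \prod_(g in x.2) w ^+ c0 g ^+ ks x.1.
pose a j (x : T) := \prod_(g in x.2) w ^+ c g j ^+ ks x.1.
have nw (x k : nat) : normc (w ^+ x ^+ k) = 1.
  by rewrite -exprM (normc_char m1 pw).
have a01 x : normc (a0 x) = 1 by rewrite normc_prod big1.
have a1 j x : normc (a j x) = 1 by rewrite normc_prod big1.
have [Q [oQ hQ]] := phase_qbp_fin n T a0 a T0 a01 a1.
exists #|T|, Q; split=> //; last first.
  rewrite cardT natrM natrX mulrA mulrAC.
  by rewrite ler_wpM2r // exprn_ge0.
pose z sigma (g : chi) := w ^+ bool_poly_eval (val g) sigma.
(* Regrouping the phases by polynomial instead of by variable turns them into powers of
   [w ^+ g(sigma)]. *)
have {}hQ sigma : accept_prob Q sigma =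
    (normc (\sum_(i < t) \sum_(S : {set chi}) \prod_(g in S) z sigma g ^+ ks i)
       / #|T|%:R) ^+ 2.
  rewrite hQ pair_big; congr ((normc _ / _) ^+ 2).
  apply: eq_bigr => -[i S] _; rewrite /a0 /a /=.
  under [RHS]eq_bigr => g _.
    rewrite /z cE (char_affine m1 pw) exprMn -prodrXl; over.
  rewrite big_split /=; congr (_ * _); rewrite exchange_big /=.
  apply: eq_bigr => j _; case: (tnth sigma j) => //.
  by rewrite big1 // => g _; rewrite expr1n.
have T0R : 0 < #|T|%:R :> R by rewrite ltr0n.
move=> sigma; split=> fs; rewrite hQ.
  have zero g : z sigma g = 1.
    by rewrite /z; have -> := (chif sigma).2 fs _ (valP g).
  have -> : \sum_(i < t) \sum_(S : {set chi}) \prod_(g in S) z sigma g ^+ ks i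
            = #|T|%:R%:C%C.
    under eq_bigr do under eq_bigr do under eq_bigr do rewrite zero expr1n.
    under eq_bigr do under eq_bigr do rewrite big1_eq.
    by rewrite pair_big sumr_const rmorph_nat.
  by rewrite normc_real ger0_norm ?divff ?expr1n ?gt_eqF ?ltW.
have [g zg] : exists g : chi, bool_poly_eval (val g) sigma != 0.
  apply/existsP; rewrite -[X in is_true X]negbK negb_exists.
  apply/negP => /forallP h.
  suff : f sigma = true by rewrite fs.
  apply/(chif sigma) => g gchi; apply/eqP.
  by have := h [` gchi]%fset; rewrite negbK.
rewrite ler_sqr ?nnegrE ?divr_ge0 ?normc_ge0 ?ler0n //.
rewrite ler_pdivrMr // cardT natrM natrX.
apply: le_trans (normc_sum _ _ _ _) _.
pose re i := Re (z sigma g ^+ ks i).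
(* One nonvanishing [g] suffices: the same [g] bounds the inner sum for each multiplier. *)
apply: (@le_trans _ _ (\sum_(i < t) 2 ^+ #|` chi| * (3 / 4 + re i / 4))).
  apply: ler_sum => i _.
  apply: le_trans (normc_subset_sum (fun g => z sigma g ^+ ks i) g _) _ => [g'|].
    exact: nw.
  rewrite -cardfE ler_wpM2l ?exprn_ge0 //.
  by have := normc_1D _ (nw (bool_poly_eval (val g) sigma) (ks i)); rewrite /re /z; lra.
rewrite -mulr_sumr mulrA [leRHS]mulrC ler_wpM2l ?exprn_ge0 //.
rewrite big_split /= sumr_const card_ord -mulr_suml -[X in X + _]mulr_natl.
have lt_m : (bool_poly_eval (val g) sigma < m)%N.
  by rewrite -[X in (_ < X)%N](Zp_cast m1) ltn_ord.
(* Balance at the nonzero residue [g(sigma)] bounds the sum of the [re i] by [t / 2]. *)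
have := ksP (Ordinal lt_m); rewrite /= lt0n => /(_ zg).
by rewrite -[\sum_i _]/(\sum_i re i); lra.
Qed.
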